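(* Let $\mathcal P^{\mathcal O}=\{P_\theta^{\mathcal O}:\theta\in\Theta\}$, $\Theta\subseteq\mathbb R^p$, be the pushforward model on $\mathcal Y$ induced by an observation operator $\mathcal O$, with Fisher information $I_{\mathcal O}(\theta)$ and score $\dot\ell_\theta^{\mathcal O}$. For any regular inference functional $\Psi$ for the pushforward model $\mathcal P^{\mathcal O}$, with Godambe information $G_\Psi(\theta)$, $$G_\Psi(\theta)\ \le\ I_{\mathcal O}(\theta)$$ in the Löwner order. Equality holds if and only if $\Psi$ is proportional to the score $\dot\ell_\theta^{\mathcal O}$ of the pushforward model.
   Context: Model: $\{P_\theta:\theta\in\Theta\subseteq\mathbb R^p\}$ is a parametric family in which each $P_\theta$ has a distributional representation $(T_\theta,\varphi)$, with $T_\theta\in\mathcal S'(\mathbb R)$ a tempered distribution and $\varphi\in\mathcal S(\mathbb R)$ a fixed Schwartz kernel not depending on $\theta$. Put $\mathcal A_\varphi=\{\psi:\psi\varphi\in\mathcal S(\mathbb R)\}$. Observation operator: a measurable map $\mathcal O:(\mathcal S'(\mathbb R),\mathcal C)\to(\mathcal Y,\mathcal B_{\mathcal Y})$ into a measurable space, where $\mathcal C$ is the cylindrical $\sigma$-algebra, the smallest one making all maps $T\mapsto\langle T,f\rangle$, $f\in\mathcal S(\mathbb R)$, measurable. The pushforward model is the family of probability measures $P_\theta^{\mathcal O}=P_\theta\circ\mathcal O^{-1}$ on $(\mathcal Y,\mathcal B_{\mathcal Y})$; $Y$ denotes an observation with this law. Score and Fisher information of the pushforward model: with $f_\theta^{\mathcal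 O}$ the density of $P_\theta^{\mathcal O}$, $\dot\ell_\theta^{\mathcal O}(y)=\partial_\theta\log f_\theta^{\mathcal O}(y)$ and $I_{\mathcal O}(\theta)=\mathrm E_{P_\theta^{\mathcal O}}[\dot\ell_\theta^{\mathcal O}(Y)\,\dot\ell_\theta^{\mathcal O}(Y)^\top]$. Regular inference functional: a measurable function $\Psi:\mathcal Y\times\Theta\to\mathbb R^p$, with $\Psi(\cdot,\theta)$ measurable for each $\theta$, such that (R1) admissibility: for each $\theta$, $\Psi(\cdot,\theta)$ belongs to a suitable class of measurable functions on $\mathcal Y$ (in the distributional setting with point observations this means $\Psi(\cdot,\theta)\in\mathcal A_\varphi$); (R2) unbiasedness: $\mathrm E_{P_\theta^{\mathcal O}}[\Psi(Y,\theta)]=0$ for all $\theta\in\Theta$; (R3) identification: the map $\theta\mapsto\mathrm E_{P_{\theta_0}^{\mathcal O}}[\Psi(Y,\theta)]$ has a unique zero, at the true parameter value $\theta_0$. Godambe information: $G_\Psi(\theta)=S(\theta)^\top V(\theta)^{-1}S(\theta)$, where $S(\theta)=-\mathrm E_{P_\theta^{\mathcal O}}[\partial_\theta\Psi(Y,\theta)]$ is the sensitivity matrix and $V(\theta)=\mathrm E_{P_\theta^{\mathcal O}}[\Psi(Y,\theta)\Psi(Y,\theta)^\top]$ is the variability matrix.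
   Formalization: At interior θ, score, S, V, V⁻¹ are assumed to exist, and ∫Ψf dμ to be differentiable under the integral (else U(0,θ), Ψ=y−θ/2 violates the bound); equality clause assumes I_O(θ) invertible; ''proportional'' means Ψ = A·score a.s. with A an invertible matrix. *)

(* Defs.v *)
From HB Require Import structures.
From mathcomp Require Import all_boot all_order all_algebra.
From mathcomp Require Import all_classical all_reals all_analysis.
Set Implicit Arguments.
Unset Strict Implicit.
Unset Printing Implicit Defensive.
Import Order.TTheory GRing.Theory Num.Theory.
Import numFieldNormedType.Exports.
Local Open Scope classical_set_scope.
Local Open Scope ring_scope.

Section schwartz_space.
Context {R : realType}.

Definition smooth (f : R -> R) : Prop :=
  forall (n : nat) (x : R), derivable (derive1n n f) x 1.

Definition schwartz_pred (f : R -> R) : Prop :=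
  smooth f /\ forall m n : nat, exists C : R, forall x : R,
    `|x ^+ m * (derive1n n f) x| <= C.

Definition schwartzb : {pred R -> R} := [pred f | `[< schwartz_pred f >]].

Lemma derive1nMD (a : R) (f g : R -> R) n : smooth f -> smooth g ->
  derive1n n (a *: f + g) = a *: derive1n n f + derive1n n g.
Proof.
move=> sf sg; elim: n => [|n IH]; first by rewrite !derive1n0.
rewrite !derive1nS IH; apply/funext => x.
rewrite [in RHS]/GRing.add /= [in RHS]/GRing.scale /= !derive1E.
rewrite deriveD; [|exact: derivableZ (sf n x)|exact: sg].
by rewrite deriveZ //; exact: sf.
Qed.

Lemma schwartz_submod : submod_closed schwartzb.
Proof.
split=> [|a f g /asboolP[sf bf] /asboolP[sg bg]]; apply/asboolP.
  have d0 n : derive1n n (0 : R -> R) = 0.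
    elim: n => [|n IH]; first by rewrite derive1n0.
    by rewrite derive1nS IH; apply/funext => x; rewrite derive1E derive_cst.
  split=> [n x|m n]; first by rewrite d0; exact: derivable_cst.
  by exists 0 => x; rewrite d0 mulr0 normr0.
split=> [n x|m n].
  rewrite derive1nMD//; apply: derivableD; last exact: sg.
  exact: derivableZ (sf n x).
have [Cf hf] := bf m n; have [Cg hg] := bg m n.
exists (`|a| * Cf + Cg) => x; rewrite derive1nMD//.
rewrite [X in _ * X](_ : _ = a * derive1n n f x + derive1n n g x)// mulrDr mulrCA.
rewrite (le_trans (ler_normD _ _))// normrM lerD// ler_wpM2l//; exact: hf.
Qed.

HB.instance Definition _ := GRing.isSubmodClosed.Build R (R -> R) schwartzb
  schwartz_submod.

(* Real-valued test functions only: the laws considered are tested against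
   real functions. *)
Record schwartz := Schwartz {
  schwartz_fun :> R -> R;
  schwartzP : schwartz_fun \in schwartzb }.

HB.instance Definition _ := [isSub for schwartz_fun].
HB.instance Definition _ := [Choice of schwartz by <:].
HB.instance Definition _ := [SubChoice_isSubLmodule of schwartz by <:].

Definition schwartz_seminorm (m n : nat) (f : schwartz) : R :=
  sup [set `|x ^+ m * (derive1n n f) x| | x in [set: R]].

(* Continuity for the locally convex topology generated by the seminorms. *)
Definition schwartz_continuous (T : schwartz -> R) : Prop :=
  forall (f : schwartz) (e : R), 0 < e ->
  exists N : nat, exists2 d : R, 0 < d &
    forall g : schwartz,
      (forall m n : nat, (m <= N)%N -> (n <= N)%N ->
         schwartz_seminorm m n (g - f) < d) ->
      `|T g - T f| < e.

Record tempered := Tempered {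
  tempered_form :> {scalar schwartz};
  temperedP : schwartz_continuous tempered_form }.

Lemma tempered0_subproof : schwartz_continuous (\0 : {scalar schwartz}).
Proof.
by move=> f e e0; exists 0%N; exists 1 => // g _; rewrite /= subrr normr0.
Qed.

HB.instance Definition _ := gen_eqMixin tempered.
HB.instance Definition _ := gen_choiceMixin tempered.
HB.instance Definition _ := isPointed.Build tempered
  (Tempered tempered0_subproof).

Definition cylinders : set (set tempered) :=
  \bigcup_(f in [set: schwartz])
    preimage_set_system [set: tempered] (fun T : tempered => T f) measurable.

Definition tempered_cyl := g_sigma_algebraType cylinders.

(* The multipliers psi with psi * phi in S(R). This is the choice of the class
   [adm] of [regular_inference_functional] when Y is the real line and the
   observations are points. *)
Definition point_admissible (phi : schwartz) : set (R -> R) :=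
  [set psi | (psi \* phi) \in schwartzb].

End schwartz_space.
Arguments schwartz R : clear implicits.
Arguments tempered R : clear implicits.
Arguments tempered_cyl R : clear implicits.

Section matrices.
Context {R : realType}.

Definition psdmx n (A : 'M[R]_n) : Prop :=
  A^T = A /\ forall x : 'cV[R]_n, 0 <= (x^T *m A *m x) 0 0.

Definition loewner_le n (A B : 'M[R]_n) : Prop := psdmx (B - A).

(* An entry is the expectation only if it is integrable: [fine] sends an
   infinite value to 0. *)
Definition Emx d (Y : measurableType d) (Q : probability Y R) m n
    (X : Y -> 'M[R]_(m, n)) : 'M[R]_(m, n) :=
  \matrix_(i, j) fine ('E_Q[fun y => X y i j])%E.

Definition Borel_cV n := g_sigma_algebraType (@open 'cV[R]_n).

Definition basis_cV n (j : 'I_n) : 'cV[R]_n := delta_mx j 0.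

Definition gradient n (g : 'cV[R]_n -> R) (t : 'cV[R]_n) : 'cV[R]_n :=
  \col_j 'D_(basis_cV j) g t.

(* Entry (i, j) is the j-th partial derivative of the i-th coordinate. *)
Definition derivative_mx n (g : 'cV[R]_n -> 'cV[R]_n) (t : 'cV[R]_n)
    : 'M[R]_n :=
  \matrix_(i, j) 'D_(basis_cV j) (fun s => g s i 0) t.

End matrices.
Arguments Borel_cV R n : clear implicits.

Section inference.
Context {R : realType} {d : measure_display} {Y : measurableType d} {p : nat}.
Implicit Types (mu : {measure set Y -> \bar R}) (Q : probability Y R).
Implicit Types (model : 'cV[R]_p -> probability Y R).
Implicit Types (f : 'cV[R]_p -> Y -> R) (Psi : Y -> 'cV[R]_p -> 'cV[R]_p).
Implicit Types (Theta : set 'cV[R]_p) (theta : 'cV[R]_p).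

Definition pushforward_model (P : 'cV[R]_p -> probability (tempered_cyl R) R)
    (O : {mfun tempered_cyl R >-> Y}) (theta : 'cV[R]_p) : probability Y R :=
  distribution (P theta) O.

Definition is_density mu Q (g : Y -> R) : Prop :=
  [/\ measurable_fun [set: Y] g, forall y, 0 <= g y &
      forall A, measurable A -> Q A = (\int[mu]_(y in A) (g y)%:E)%E].

Definition score f theta (y : Y) : 'cV[R]_p :=
  gradient (fun t => ln (f t y)) theta.

Definition fisher_information model f theta : 'M[R]_p :=
  Emx (model theta) (fun y => score f theta y *m (score f theta y)^T).

Definition sensitivity model Psi theta : 'M[R]_p :=
  - Emx (model theta) (fun y => derivative_mx (Psi y) theta).

Definition variability model Psi theta : 'M[R]_p :=
  Emx (model theta) (fun y => Psi y theta *m (Psi y theta)^T).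

Definition godambe_information model Psi theta : 'M[R]_p :=
  (sensitivity model Psi theta)^T
    *m invmx (variability model Psi theta)
    *m sensitivity model Psi theta.

Definition zero_mean Q (g : Y -> 'cV[R]_p) : Prop :=
  (forall i, Q.-integrable [set: Y] (fun y => (g y i 0)%:E)) /\ Emx Q g = 0.

(* Measurability with respect to the trace of the product sigma-algebra on
   Y x Theta, so that Theta itself need not be a Borel set. *)
Definition jointly_measurable Theta Psi : Prop :=
  forall B : set (Borel_cV R p), measurable B ->
  exists2 A : set (Y * Borel_cV R p), measurable A &
    [set: Y] `*` Theta `&` [set z | B (Psi z.1 z.2)] =
    [set: Y] `*` Theta `&` A.

Record regular_inference_functional (adm : set (Y -> R)) Theta model Psi
    : Prop := {
  rif_joint_measurable : jointly_measurable Theta Psi;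
  rif_measurable : forall theta, Theta theta ->
    measurable_fun [set: Y] (fun y => Psi y theta : Borel_cV R p);
  rif_admissible : forall theta, Theta theta ->
    forall i, adm (fun y => Psi y theta i 0);
  rif_unbiased : forall theta, Theta theta ->
    zero_mean (model theta) (Psi ^~ theta);
  rif_identification : forall theta0 theta, Theta theta0 -> Theta theta ->
    zero_mean (model theta0) (Psi ^~ theta) <-> theta = theta0 }.

(* What is needed for the score and the Fisher information to exist at theta.
   Where the density is positive, its partial derivatives give those of its
   logarithm, and this is almost everywhere for the law at theta. *)
Record fisher_regular mu model f theta : Prop := {
  fr_derivable : {ae mu, forall y, forall j,
    derivable (fun t => f t y) theta (basis_cV j)};
  fr_square_integrable : forall j,
    (fun y => score f theta y j 0) \in Lfun (model theta) 2%:E }.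

(* What is needed for the Godambe information to exist at theta, and Godambe's
   regularity condition: the integral of Psi with respect to the law at theta
   can be differentiated under the integral sign. *)
Record godambe_regular mu model f Psi theta : Prop := {
  gr_derivable : {ae mu, forall y, forall i j,
    derivable (fun t => Psi y t i 0) theta (basis_cV j)};
  gr_integrable : forall i j,
    (fun y => derivative_mx (Psi y) theta i j) \in Lfun (model theta) 1%:E;
  gr_square_integrable : forall i,
    (fun y => Psi y theta i 0) \in Lfun (model theta) 2%:E;
  gr_variability : variability model Psi theta \in unitmx;
  gr_under_integral : forall i j,
    let D y := 'D_(basis_cV j) (fun t => Psi y t i 0 * f t y) theta in
    mu.-integrable [set: Y] (EFin \o D) /\
    'D_(basis_cV j) (fun t => \int[mu]_y (Psi y t i 0 * f t y)) theta =
      \int[mu]_y D y }.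

(* Proportionality in dimension p: the factor is an invertible matrix which
   does not depend on the observation. *)
Definition proportional_to_score model f Psi theta : Prop :=
  exists2 A : 'M[R]_p, A \in unitmx &
    {ae model theta, forall y, Psi y theta = A *m score f theta y}.

End inference.

(* Main.v *)
Require Import Defs.
From mathcomp Require Import all_boot all_order all_algebra.
From mathcomp Require Import all_classical all_reals all_analysis.
From mathcomp Require Import measurable_realfun ring.
Set Implicit Arguments.
Unset Strict Implicit.
Unset Printing Implicit Defensive.
Import Order.TTheory GRing.Theory Num.Theory.
Import numFieldNormedType.Exports.
Local Open Scope classical_set_scope.
Local Open Scope ring_scope.

(* Let Q be the law at theta, s the score and X = Psi(., theta).  Unbiasedness
   says that t |-> int Psi(., t) f_t dmu vanishes near theta; differentiating
   it under the integral sign gives S = E_Q[X s^T] for the sensitivity S.  With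
   V = E_Q[X X^T], the residual r = s - S^T V^-1 X of the projection of s on
   the span of X in L^2(Q) satisfies E_Q[r r^T] = I - S^T V^-1 S, which is
   positive semidefinite, and vanishes exactly when r = 0 almost surely. *)

(** * Directional derivatives at a minimum and of a logarithm *)

Section directional_derivative.
Variables (R : realType) (V : normedModType R).
Implicit Types (g : V -> R) (x v : V).

(** The increment of [g] is nonnegative along the line through [x], so the difference quotient is
    nonpositive for [h < 0] and nonnegative for [h > 0]; both one-sided limits equal the
    derivative. *)
Lemma derive_local_min g x v : derivable g x v ->
  (\forall y \near x, g x <= g y) -> 'D_v g x = 0.
Proof.
move=> dg gmin.
have min_line : \forall h \near (0 : R), g x <= g (h *: v + x).
  have : (fun h : R => h *: v + x) @ 0 --> (x : V).
    rewrite -[X in _ --> X]add0r -[X in _ --> X + _](scale0r v).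
    by apply: cvgD; [apply: cvgZr_tmp; exact: cvg_id|exact: cvg_cst].
  exact: (fun c => c _ gmin).
apply/eqP; rewrite eq_le; apply/andP; split.
- rewrite ['D_v g x]cvg_at_leftE; last exact: dg.
  apply: limr_le; first exact: (cvgP _ (cvg_dnbhs_at_left dg)).
  near=> h; rewrite /= /GRing.scale /=; apply: mulr_le0_ge0.
    by rewrite invr_le0.
  by rewrite subr_ge0; near: h; apply: cvg_within; exact: min_line.
- rewrite ['D_v g x]cvg_at_rightE; last exact: dg.
  apply: limr_ge; first exact: (cvgP _ (cvg_dnbhs_at_right dg)).
  near=> h; rewrite /= /GRing.scale /=; apply: mulr_ge0.
    by rewrite invr_ge0.
  by rewrite subr_ge0; near: h; apply: cvg_within; exact: min_line.
Unshelve. all: by end_near. Qed.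

Lemma derive_ln g x v : 0 < g x -> derivable g x v ->
  'D_v (fun y => ln (g y)) x = (g x)^-1 * 'D_v g x.
Proof.
move=> gx0 dg.
(* Derivability is known in the single direction [v], so everything is restricted to the line
   [h *: v + x] and the one-variable chain rule is applied at [h = 0]. *)
pose l (F : V -> R) (h : R) := F (h *: v + x).
have E F : 'D_v F x = (l F)^`()%classic 0.
  rewrite derive1E /derive.
  set q1 := fun h => _; set q2 := fun h => _; suff -> : q1 = q2 by [].
  by apply/funext => h; rewrite /q1 /q2 /l /= addr0 scale0r add0r [_%:A]mulr1.
have dg1 : derivable (l g) 0 1 by exact: (derivable1P g x v).1 dg.
have l0 : l g 0 = g x by rewrite /l scale0r add0r.
rewrite !E; have -> : l (fun y => ln (g y)) = @ln R \o l g by [].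
have dln : is_derive (l g 0) 1 (@ln R) (g x)^-1
  by rewrite l0; exact: is_derive1_ln.
rewrite (derive1_comp dg1 (@ex_derive _ _ _ _ _ _ _ dln)).
by rewrite [in X in X * _]derive1E derive_val.
Qed.

End directional_derivative.

(** * Change of measure from a law to its density *)

Section density.
Context {R : realType} {d : measure_display} {Y : measurableType d}.
Variables (mu : {measure set Y -> \bar R}) (Q : probability Y R) (g : Y -> R).
Hypothesis gQ : is_density mu Q g.

Let mg : measurable_fun [set: Y] (fun y => (g y)%:E).
Proof. by apply/measurable_EFinP; case: gQ. Qed.

Let g0 y : (0 <= (g y)%:E)%E.
Proof. by rewrite lee_fin; case: gQ. Qed.

Import HBNNSimple.

(** By linearity over the level sets of [h] it is enough to treat an indicator, where the identity
    is the defining property of the density. *)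
Lemma integral_density_nnsfun (h : {nnsfun Y >-> R}) :
  (\int[Q]_y (h y)%:E = \int[mu]_y ((h y)%:E * (g y)%:E))%E.
Proof.
have hE y : (h y)%:E = (\sum_(r \in range h) (r * \1_(h @^-1` [set r]) y)%:E)%E.
  by rewrite fsumEFin// -fimfunE.
have r0 r y : (0 <= (r * \1_(h @^-1` [set r]) y)%:E)%E.
  exact: nnfun_muleindic_ge0.
have mr r : measurable_fun [set: Y] (fun y => (r * \1_(h @^-1` [set r]) y)%:E).
  by apply/measurable_EFinP; exact: measurable_funM.
have -> : (\int[Q]_y (h y)%:E =
    \sum_(r \in range h) \int[Q]_y (r * \1_(h @^-1` [set r]) y)%:E)%E.
  by rewrite -ge0_integral_fsum//; apply: eq_integral => y _; exact: hE.
have -> : (\int[mu]_y ((h y)%:E * (g y)%:E) = \sum_(r \in range h)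
    \int[mu]_y ((r * \1_(h @^-1` [set r]) y)%:E * (g y)%:E))%E.
  rewrite -ge0_integral_fsum//.
  - by apply: eq_integral => y _; rewrite hE ge0_mule_fsuml.
  - by move=> r; exact: emeasurable_funM.
  - by move=> r y _; rewrite mule_ge0.
apply: eq_fsbigr => _ /set_mem[z _ <-]; set A := h @^-1` _.
have mA : measurable A by exact: measurable_sfunP.
under eq_integral do rewrite EFinM -muleA.
under [LHS]eq_integral do rewrite EFinM.
have hz0 : (0 <= (h z)%:E)%E by rewrite lee_fin.
rewrite !ge0_integralZl//.
- congr (_ * _)%E; rewrite integral_indic// setIT.
  have [_ _ /(_ _ mA) QA] := gQ; apply: etrans QA _.
  rewrite integral_mkcond; apply: eq_integral => y _.
  by rewrite patchE indicE; case: ifPn => _; rewrite ?mul1e ?mul0e.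
- apply: emeasurable_funM => //; apply/measurable_EFinP.
  exact: measurable_indic.
- by move=> y _; rewrite mule_ge0// lee_fin.
- by apply/measurable_EFinP; exact: measurable_indic.
Qed.

(** Monotone convergence along simple functions increasing to [h], on both sides: the two integrals
    are limits of the same sequence. *)
Lemma ge0_integral_density (h : Y -> \bar R) :
  measurable_fun [set: Y] h -> (forall y, (0 <= h y)%E) ->
  (\int[Q]_y h y = \int[mu]_y (h y * (g y)%:E))%E.
Proof.
move=> mh h0; pose a := nnsfun_approx measurableT mh.
have a_cvg y : ((a n y)%:E @[n --> \oo] --> h y)%E by exact: cvg_nnsfun_approx.
have a_nd y : {homo (fun n => (a n y)%:E) : n m / (n <= m)%N >-> (n <= m)%E}.
  by move=> n m nm; rewrite lee_fin; exact/lefP/nd_nnsfun_approx.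
have Qa : (\int[Q]_y (a n y)%:E @[n --> \oo] --> \int[Q]_y h y)%E.
  under [X in _ --> X]eq_integral do rewrite -(cvg_lim _ (a_cvg _))//.
  apply: cvg_monotone_convergence => //.
  - by move=> n; exact/measurable_EFinP.
  - by move=> n y _; rewrite lee_fin.
have mua : (\int[mu]_y ((a n y)%:E * (g y)%:E) @[n --> \oo] -->
    \int[mu]_y (h y * (g y)%:E))%E.
  have ag_cvg y : ((a n y)%:E * (g y)%:E @[n --> \oo] --> h y * (g y)%:E)%E.
    by apply: cvgeZr.
  under [X in _ --> X]eq_integral do rewrite -(cvg_lim _ (ag_cvg _))//.
  apply: cvg_monotone_convergence => //.
  - by move=> n; apply: emeasurable_funM => //; exact/measurable_EFinP.
  - by move=> n y _; rewrite mule_ge0// lee_fin.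
  - by move=> y _ n m nm; rewrite lee_wpmul2r// a_nd.
move: Qa; under eq_fun do rewrite integral_density_nnsfun.
by move=> /cvg_unique; apply.
Qed.

(** Since [g] is nonnegative, the positive and negative parts of [h * g] are those of [h] multiplied
    by [g]. *)
Lemma integral_density (h : Y -> R) : measurable_fun [set: Y] h ->
  (\int[Q]_y (h y)%:E = \int[mu]_y (h y * g y)%:E)%E.
Proof.
move=> mh; rewrite [LHS]integralE [RHS]integralE.
have mEh : measurable_fun [set: Y] (fun y => (h y)%:E).
  exact/measurable_EFinP.
rewrite !ge0_integral_density//; last 2 first.
- exact: measurable_funeneg.
- exact: measurable_funepos.
congr (_ - _)%E; apply: eq_integral => y _.
  rewrite !funeposE muleC maxe_pMr ?mule0 -?EFinM ?[g y * _]mulrC//.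
rewrite !funenegE muleC maxe_pMr ?mule0 -?EFinN -?EFinM//.
by rewrite mulrN [g y * _]mulrC.
Qed.

End density.

(** * Expectations of random matrices and second moments *)

Section expectation_matrix.
Context {R : realType} {d : measure_display} {Y : measurableType d}.
Variable Q : probability Y R.

Definition mx_integrable m n (X : Y -> 'M[R]_(m, n)) : Prop :=
  forall i j, Q.-integrable [set: Y] (fun y => (X y i j)%:E).

Lemma EmxE m n (X : Y -> 'M[R]_(m, n)) i j :
  Emx Q X i j = \int[Q]_y X y i j.
Proof. by rewrite mxE unlock. Qed.

Lemma Emx_tr m n (X : Y -> 'M[R]_(m, n)) :
  Emx Q (fun y => (X y)^T) = (Emx Q X)^T.
Proof.
apply/matrixP => i j; rewrite [RHS]mxE !EmxE.
by apply: eq_Rintegral => y _; rewrite mxE.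
Qed.

Lemma mx_integrable_tr m n (X : Y -> 'M[R]_(m, n)) :
  mx_integrable X -> mx_integrable (fun y => (X y)^T).
Proof. by move=> iX i j; under eq_fun do rewrite mxE; exact: iX. Qed.

Lemma EmxD m n (X Z : Y -> 'M[R]_(m, n)) :
  mx_integrable X -> mx_integrable Z ->
  Emx Q (fun y => X y + Z y) = Emx Q X + Emx Q Z.
Proof.
move=> iX iZ; apply/matrixP => i j; rewrite [RHS]mxE !EmxE -RintegralD//.
- by apply: eq_Rintegral => y _; rewrite mxE.
- exact: iX.
- exact: iZ.
Qed.

Lemma mx_integrable_mulmxl l m n (A : 'M[R]_(l, m)) (X : Y -> 'M[R]_(m, n)) :
  mx_integrable X -> mx_integrable (fun y => A *m X y).
Proof.
move=> iX i j; under eq_fun do rewrite mxE -sumEFin.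
apply: integrable_sum => // k _; under eq_fun do rewrite EFinM.
by apply: integrableZl => //; exact: iX.
Qed.

Lemma Emx_mulmxl l m n (A : 'M[R]_(l, m)) (X : Y -> 'M[R]_(m, n)) :
  mx_integrable X -> Emx Q (fun y => A *m X y) = A *m Emx Q X.
Proof.
move=> iX; apply/matrixP => i j; rewrite EmxE [RHS]mxE.
transitivity (\int[Q]_y \sum_k A i k * X y k j).
  by apply: eq_Rintegral => y _; rewrite mxE.
under [RHS]eq_bigr do rewrite EmxE.
(* The sum becomes one over a list, so that it leaves the integral by induction, one summand at a
   time. *)
rewrite -big_enum/=; under eq_Rintegral do rewrite -big_enum/=.
elim: (enum _) => [|k s IH].
  rewrite big_nil; under eq_Rintegral do rewrite big_nil.
  by rewrite Rintegral_cst// mul0r.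
have iAX a : Q.-integrable [set: Y] (EFin \o (fun y => A i a * X y a j)).
  rewrite /comp; under eq_fun do rewrite EFinM.
  by apply: integrableZl => //; exact: iX.
under eq_Rintegral do rewrite big_cons.
rewrite big_cons RintegralD//.
  by rewrite IH RintegralZl//; exact: iX.
rewrite /comp; under eq_fun do rewrite -sumEFin.
by apply: integrable_sum => // a _; exact: iAX.
Qed.

Lemma Emx_mulmxr l m n (A : 'M[R]_(n, l)) (X : Y -> 'M[R]_(m, n)) :
  mx_integrable X -> Emx Q (fun y => X y *m A) = Emx Q X *m A.
Proof.
move=> iX; apply: trmx_inj; rewrite -Emx_tr trmx_mul -Emx_tr.
rewrite -Emx_mulmxl; last exact: mx_integrable_tr.
by under eq_fun do rewrite trmx_mul.
Qed.

Lemma eq_ae_Emx m n (X Z : Y -> 'M[R]_(m, n)) :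
  mx_integrable X -> mx_integrable Z -> {ae Q, forall y, X y = Z y} ->
  Emx Q X = Emx Q Z.
Proof.
move=> iX iZ XZ; apply/matrixP => i j; rewrite !EmxE /Rintegral; congr fine.
apply: ae_eq_integral => //.
- exact: measurable_int (iX i j).
- exact: measurable_int (iZ i j).
- by apply: filterS XZ => y /= -> _.
Qed.

(** The matrix of inner products in L^2(Q) of the coordinates of [X] with those of [Z]; the Gram
    matrix when [X = Z]. *)
Definition cross_moment n (X Z : Y -> 'cV[R]_n) : 'M[R]_n :=
  Emx Q (fun y => X y *m (Z y)^T).

Definition square_integrable n (X : Y -> 'cV[R]_n) : Prop :=
  forall i, (fun y => X y i 0) \in Lfun Q 2%:E.

Variable n : nat.
Implicit Types X Z : Y -> 'cV[R]_n.

Lemma square_integrable_outer X Z :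
  square_integrable X -> square_integrable Z ->
  mx_integrable (fun y => X y *m (Z y)^T).
Proof.
move=> X2 Z2 i j; have /Lfun1_integrable := Lfun2_mul_Lfun1 (X2 i) (Z2 j).
apply: eq_integrable => // y _ /=.
by rewrite mxE big_ord1 mxE.
Qed.

Lemma square_integrable_mulmxl X (A : 'M[R]_n) :
  square_integrable X -> square_integrable (fun y => A *m X y).
Proof.
move=> X2 i; have [L0 LD] := Lfun_submod_closed Q (lee1n 2).
have -> : (fun y => (A *m X y) i 0) = \sum_k A i k *: (fun y => X y k 0).
  by apply/funext => y; rewrite mxE fct_sumE.
elim/big_ind : _ => [//|u v Lu Lv|k _]; first by rewrite -[u]scale1r LD.
by rewrite -[_ *: _]addr0 LD//; exact: X2.
Qed.

Lemma square_integrable_affine X Z (A : 'M[R]_n) :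
  square_integrable X -> square_integrable Z ->
  square_integrable (fun y => X y + A *m Z y).
Proof.
move=> X2 Z2 i; have [_ LD] := Lfun_submod_closed Q (lee1n 2).
have -> : (fun y => (X y + A *m Z y) i 0) =
    1 *: (fun y => X y i 0) + (fun y => (A *m Z y) i 0).
  by apply/funext => y; rewrite scale1r mxE.
by apply: LD; [exact: X2|exact: square_integrable_mulmxl].
Qed.

(** The quadratic form at [x] is the expectation of the square of the scalar [x^T *m X]. *)
Lemma cross_moment_psd X : square_integrable X -> psdmx (cross_moment X X).
Proof.
move=> X2; have iXX := square_integrable_outer X2 X2; split.
  rewrite /cross_moment -Emx_tr.
  by under eq_fun do rewrite trmx_mul trmxK.
move=> x; rewrite /cross_moment -Emx_mulmxl// -Emx_mulmxr; last first.
  exact: mx_integrable_mulmxl.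
rewrite EmxE; apply: Rintegral_ge0 => y _.
rewrite mulmxA -mulmxA mxE big_ord1.
have -> : (X y)^T *m x = (x^T *m X y)^T by rewrite trmx_mul trmxK.
by rewrite [in X in _ * X]mxE -expr2 sqr_ge0.
Qed.

(** Each diagonal entry is the integral of the square of a coordinate; when it is zero, that
    coordinate vanishes almost surely. *)
Lemma cross_moment_eq0 X : square_integrable X -> cross_moment X X = 0 ->
  {ae Q, forall y, X y = 0}.
Proof.
move=> X2 XX0.
suff H i : {ae Q, forall y, X y i 0 = 0}.
  apply: filterS (filter_forall _ H) => y Xy0.
  by apply/matrixP => i j; rewrite ord1 mxE Xy0.
have iXi := Lfun2_integrable_sqr (X2 i).
have Xi0 : (\int[Q]_y `|(X y i 0 ^+ 2)%:E| = 0)%E.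
  under eq_integral do rewrite gee0_abs ?lee_fin ?sqr_ge0//.
  have /matrixP/(_ i i) := XX0; rewrite EmxE [RHS]mxE => H.
  rewrite -(fineK (integrable_fin_num measurableT iXi)).
  congr (_%:E); rewrite -[RHS]H; apply: eq_Rintegral => y _.
  by rewrite mxE big_ord1 mxE expr2.
have := (ae_eq_integral_abs Q measurableT (measurable_int _ iXi)).1 Xi0.
apply: filterS => y /(_ I) /= [/eqP]; rewrite sqrf_eq0 => /eqP; exact.
Qed.

Lemma cross_momentDl X Z W (A : 'M[R]_n) :
  square_integrable X -> square_integrable Z -> square_integrable W ->
  cross_moment (fun y => X y + A *m Z y) W =
  cross_moment X W + A *m cross_moment Z W.
Proof.
move=> X2 Z2 W2; rewrite /cross_moment.
have iXW := square_integrable_outer X2 W2.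
have iZW := square_integrable_outer Z2 W2.
rewrite -Emx_mulmxl// -EmxD//; last exact: mx_integrable_mulmxl.
by under eq_fun do rewrite mulmxDl -mulmxA.
Qed.

Lemma cross_moment_tr X Z : (cross_moment X Z)^T = cross_moment Z X.
Proof.
by rewrite /cross_moment -Emx_tr; under eq_fun do rewrite trmx_mul trmxK.
Qed.

Lemma cross_moment_mulmxl X Z A : square_integrable X -> square_integrable Z ->
  cross_moment (fun y => A *m X y) Z = A *m cross_moment X Z.
Proof.
move=> X2 Z2; have iXZ := square_integrable_outer X2 Z2.
rewrite /cross_moment -Emx_mulmxl//.
by under eq_fun do rewrite -mulmxA.
Qed.

(** Pythagoras in L^2(Q): [r] is what remains of [s] after projection on the span of the coordinates
    of [X]. *)
Lemma cross_moment_residual X s (S := cross_moment X s) (V := cross_moment X X)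
    (r := fun y => s y + (- (S^T *m invmx V)) *m X y) :
  square_integrable X -> square_integrable s -> V \in unitmx ->
  cross_moment r r = cross_moment s s - S^T *m invmx V *m S.
Proof.
move=> X2 s2 uV; have r2 := square_integrable_affine (- (S^T *m invmx V)) s2 X2.
have VT : V^T = V by exact: cross_moment_tr.
(* The normal equations: E[r X^T] = S^T - S^T V^-1 V = 0. *)
have Xr0 : cross_moment X r = 0.
  rewrite -cross_moment_tr cross_momentDl// -(cross_moment_tr X s) -/S -/V.
  by rewrite mulNmx mulmxKV// subrr trmx0.
rewrite [LHS]cross_momentDl// Xr0 mulmx0 addr0.
rewrite -cross_moment_tr cross_momentDl// linearD /= cross_moment_tr -/S.
by rewrite mulNmx linearN/= !trmx_mul trmxK trmx_inv VT mulmxA.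
Qed.

(** With X = A s and I = E[s s^T], one gets S = A I and V = A I A^T, hence V^-1 S = (A^T)^-1 and S^T
    V^-1 S = I A^T (A^T)^-1 = I. *)
Lemma proportional_information X s (A : 'M[R]_n) (S := cross_moment X s)
    (V := cross_moment X X) :
  square_integrable X -> square_integrable s ->
  A \in unitmx -> cross_moment s s \in unitmx ->
  {ae Q, forall y, X y = A *m s y} ->
  S^T *m invmx V *m S = cross_moment s s.
Proof.
move=> X2 s2 uA uI XA; set I := cross_moment s s.
have As2 := square_integrable_mulmxl A s2.
have IT : I^T = I by exact: cross_moment_tr.
have SE : S = A *m I.
  rewrite -cross_moment_mulmxl//; apply: eq_ae_Emx.
  - exact: square_integrable_outer.
  - exact: square_integrable_outer.
  - by apply: filterS XA => y ->.
have VE : V = A *m I *m A^T.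
  transitivity (cross_moment (fun y => A *m s y) (fun y => A *m s y)).
    apply: eq_ae_Emx.
    - exact: square_integrable_outer.
    - exact: square_integrable_outer.
    - by apply: filterS XA => y ->.
  rewrite cross_moment_mulmxl// -cross_moment_tr cross_moment_mulmxl//.
  by rewrite trmx_mul -/I IT mulmxA.
have uAT : A^T \in unitmx by rewrite unitmx_tr.
have uV : V \in unitmx by rewrite VE !unitmx_mul uA uI.
have SV : S = V *m invmx A^T by rewrite VE mulmxK// SE.
by rewrite [X in _ *m X]SV mulmxA mulmxKV// SE trmx_mul IT mulmxK.
Qed.

End expectation_matrix.

(** * The information inequality and its equality case *)

Section information_bound.
Context {R : realType} {d : measure_display} {Y : measurableType d} {p : nat}.
Variables (mu : {measure set Y -> \bar R}).
Variables (model : 'cV[R]_p -> probability Y R) (f : 'cV[R]_p -> Y -> R).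
Variables (Psi : Y -> 'cV[R]_p -> 'cV[R]_p) (Theta : set 'cV[R]_p).
Variable theta : 'cV[R]_p.
Hypothesis model_density : forall t, Theta t -> is_density mu (model t) (f t).
Hypothesis unbiased : forall t, Theta t -> zero_mean (model t) (Psi ^~ t).
Hypothesis theta_interior : interior Theta theta.
Hypothesis hI : fisher_regular mu model f theta.
Hypothesis hG : godambe_regular mu model f Psi theta.

Let Q := model theta.
Let X := Psi ^~ theta.
Let s := score f theta.

Let Theta_theta : Theta theta.
Proof. exact: (interior_subset theta_interior). Qed.

Let X2 : square_integrable Q X.
Proof. by move=> i; exact: (gr_square_integrable hG). Qed.

Let s2 : square_integrable Q s.
Proof. by move=> i; exact: (fr_square_integrable hI). Qed.

(* Where the density vanishes it attains its minimum over [Theta], so that its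
   derivative vanishes too and the junk value of the score plays no role. *)
Lemma derive_density y j : derivable (f^~ y) theta (basis_cV j) ->
  'D_(basis_cV j) (f^~ y) theta = f theta y * s y j 0.
Proof.
move=> df; have [_ f0 _] := model_density Theta_theta.
rewrite [s y j 0]mxE; have [f_gt0|f_le0] := ltP 0 (f theta y).
  by rewrite derive_ln// mulrA divff ?mul1r// gt_eqF.
have fE : f theta y = 0 by apply/eqP; rewrite eq_le f_le0 f0.
rewrite fE mul0r; apply: derive_local_min => //; rewrite fE.
by apply: filterS theta_interior => t Tt; have [_ /(_ y)] := model_density Tt.
Qed.

(** As [theta] is interior, every nearby t lies in [Theta], where the integral is the expectation of
    Psi(., t) under the law at t, namely 0. The function differentiated is thus locally constant. *)
Lemma derive_unbiasedness i j :
  'D_(basis_cV j) (fun t => \int[mu]_y (Psi y t i 0 * f t y)) theta = 0.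
Proof.
rewrite (@near_eq_derive _ _ _ _ (cst 0)) ?derive_cst//.
apply: filterS theta_interior => t Tt.
have [/(_ i) iPsi EPsi] := unbiased Tt.
have <- : Emx (model t) (Psi ^~ t) i 0 = 0 by rewrite EPsi mxE.
have mPsi : measurable_fun [set: Y] (fun y => Psi y t i 0).
  exact/measurable_EFinP/(measurable_int _ iPsi).
by rewrite EmxE /Rintegral (integral_density (model_density Tt) mPsi).
Qed.

(** The product rule gives D(Psi f) = (D Psi + Psi s^T) f almost everywhere for [mu]. The integral
    of the left side is the derivative of the unbiasedness identity, hence 0. *)
Lemma sensitivity_cross_moment :
  sensitivity model Psi theta = cross_moment Q X s.
Proof.
apply/matrixP => i j; rewrite [LHS]mxE !EmxE.
pose dPsi y := derivative_mx (Psi y) theta i j.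
pose Xs y := (X y *m (s y)^T) i j.
have idPsi : Q.-integrable [set: Y] (EFin \o dPsi).
  by apply/Lfun1_integrable; exact: (gr_integrable hG).
have iXs : Q.-integrable [set: Y] (EFin \o Xs).
  exact: (square_integrable_outer X2 s2).
(* The sign in [sensitivity] turns the claim into the vanishing of this sum. *)
suff : \int[Q]_y (dPsi y + Xs y) = 0.
  by rewrite RintegralD// => /eqP; rewrite addrC addr_eq0 => /eqP.
have mh : measurable_fun [set: Y] (fun y => dPsi y + Xs y).
  apply: measurable_funD; apply/measurable_EFinP.
    exact: (measurable_int _ idPsi).
  exact: (measurable_int _ iXs).
have [iD DE] := gr_under_integral hG i j.
(* Both sides become integrals against [mu], whose integrands can be compared almost everywhere. *)
rewrite /Rintegral (integral_density (model_density Theta_theta) mh).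
rewrite -(derive_unbiasedness i j) DE /Rintegral; congr fine.
apply: ae_eq_integral => //.
- apply/measurable_EFinP; apply: measurable_funM => //.
  by have [] := model_density Theta_theta.
- exact: measurable_int iD.
apply: filterS2 (fr_derivable hI) (gr_derivable hG) => y df dPsi_y _.
rewrite [X in _ = X%:E](deriveM (dPsi_y i j) (df j)) derive_density//.
have -> : dPsi y = 'D_(basis_cV j) (fun t => Psi y t i 0) theta.
  by rewrite /dPsi mxE.
have -> : Xs y = Psi y theta i 0 * s y j 0.
  by rewrite /Xs mxE big_ord1 [(s y)^T _ _]mxE.
by congr (_%:E); rewrite /GRing.scale /=; ring.
Qed.

Lemma godambe_le_fisher :
  loewner_le (godambe_information model Psi theta)
    (fisher_information model f theta).
Proof.
rewrite /loewner_le /godambe_information sensitivity_cross_moment.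
rewrite -[fisher_information _ _ _]/(cross_moment Q s s).
rewrite -[variability _ _ _]/(cross_moment Q X X).
rewrite -cross_moment_residual//; last exact: (gr_variability hG).
exact/cross_moment_psd/square_integrable_affine.
Qed.

(** Equality makes the residual vanish, so that s = S^T V^-1 X almost surely. Solving for X requires
    S to be invertible, which is where the invertibility of the Fisher information enters. *)
Lemma godambe_eq_fisher : fisher_information model f theta \in unitmx ->
  godambe_information model Psi theta = fisher_information model f theta <->
  proportional_to_score model f Psi theta.
Proof.
rewrite /godambe_information sensitivity_cross_moment.
rewrite -[fisher_information _ _ _]/(cross_moment Q s s).
rewrite -[variability _ _ _]/(cross_moment Q X X).
have uV : cross_moment Q X X \in unitmx := gr_variability hG.
set S := cross_moment Q X s => uI; split=> [GI|[A uA XA]]; last first.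
  exact: proportional_information uA uI XA.
(* The factors of the invertible product S^T V^-1 S are square, hence invertible. *)
have [uST uS] : S^T \in unitmx /\ S \in unitmx.
  by move: uI; rewrite -GI !unitmx_mul => /andP[/andP[-> _] ->].
(* The factor is read off from s = S^T V^-1 X, which gives X = V (S^T)^-1 s. *)
exists (cross_moment Q X X *m invmx S^T).
  by rewrite unitmx_mul uV unitmx_inv.
have := cross_moment_residual X2 s2 uV; rewrite GI subrr => /cross_moment_eq0.
move=> /(_ (square_integrable_affine _ s2 X2)); apply: filterS => y /eqP.
rewrite mulNmx subr_eq0 -[score f theta y]/(s y) => /eqP ->.
by rewrite -!mulmxA mulKmx// mulKVmx.
Qed.

End information_bound.

Theorem corollary5p5 (R : realType) (p : nat) (Theta : set 'cV[R]_p)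
  (P : 'cV[R]_p -> probability (tempered_cyl R) R)
  (T : 'cV[R]_p -> tempered R) (phi : schwartz R)
  (* any relation "(T, phi) is a distributional representation of P" *)
  (represents : tempered R -> schwartz R ->
     probability (tempered_cyl R) R -> Prop)
  (hP : forall theta, Theta theta -> represents (T theta) phi (P theta))
  (d : measure_display) (Y : measurableType d)
  (O : {mfun tempered_cyl R >-> Y})
  (mu : {measure set Y -> \bar R}) (f : 'cV[R]_p -> Y -> R)
  (hf : forall theta, Theta theta ->
     is_density mu (pushforward_model P O theta) (f theta))
  (* any class of admissible functions, cf. point_admissible *)
  (adm : set (Y -> R))
  (Psi : Y -> 'cV[R]_p -> 'cV[R]_p)
  (hPsi : regular_inference_functional adm Theta (pushforward_model P O) Psi)
  (theta : 'cV[R]_p) (htheta : interior Theta theta)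
  (hI : fisher_regular mu (pushforward_model P O) f theta)
  (hG : godambe_regular mu (pushforward_model P O) f Psi theta) :
  loewner_le (godambe_information (pushforward_model P O) Psi theta)
             (fisher_information (pushforward_model P O) f theta) /\
  (fisher_information (pushforward_model P O) f theta \in unitmx ->
   (godambe_information (pushforward_model P O) Psi theta =
      fisher_information (pushforward_model P O) f theta <->
    proportional_to_score (pushforward_model P O) f Psi theta)).
Proof.
have unbiased t : Theta t -> zero_mean (pushforward_model P O t) (Psi ^~ t).
  by move=> Tt; exact: (rif_unbiased hPsi).
split; first exact: godambe_le_fisher hf unbiased htheta hI hG.
exact: godambe_eq_fisher hf unbiased htheta hI hG.
Qed.
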